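(* Let $\mathbf{y}=\Phi(\mathbf{x})+\boldsymbol{\epsilon}$ and let $\{\mathbf{x}_n\}$ be the sequence generated, from an initial vector $\mathbf{x}_0$, by the iteration $$\mathbf{x}_{n+1}=H_s\left(\mathbf{x}_n+\Phi_{\mathbf{x}_n}^*(\mathbf{y}-\Phi_{\mathbf{x}_n}\mathbf{x}_n)\right),$$ where $\Phi_{\mathbf{x}_n}$ is the linearization of $\Phi$ at $\mathbf{x}_n$. Suppose that $\Phi_{\mathbf{x}_n}$ obeys the coherence estimate $\mu(\Phi_{\mathbf{x}_n})\le\mu_0$ for all $n\ge1$. If $\mathbf{x}$ is $s$-sparse and $\mu_0<\frac{1}{3s+1}$, then for all $n\ge 1$ $$\|\mathbf{x}_n-\mathbf{x}\|_1\le\rho\,\|\mathbf{x}_{n-1}-\mathbf{x}\|_1+(3s+1)\,\|\Phi_{\mathbf{x}_n}^*\mathbf{e}_n\|_\infty,$$ where $\mathbf{e}_n=\Phi(\mathbf{x})-\Phi_{\mathbf{x}_n}\mathbf{x}+\boldsymbol{\epsilon}$ and $\rho=\mu_0(3s+1)$.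
   Context: Here $\Phi$ is a (possibly nonlinear) map taking vectors of length $N$ to vectors of length $m$, $\mathbf{x}$ is the unknown vector of length $N$, $\boldsymbol{\epsilon}$ is a noise vector of length $m$, and $\mathbf{y}$ is the vector of observations. For each $n$, $\Phi_{\mathbf{x}_n}$ is an $m\times N$ matrix, the linearization of $\Phi$ at the point $\mathbf{x}_n$. A vector is $s$-sparse if it has $s$ nonzero entries. $H_s$ is the nonlinear hard thresholding operator that sets all but the $s$ largest (in absolute value) entries of a vector to zero. $A^*$ denotes the adjoint of a matrix $A$, and $A_j$ its $j$th column. The (mutual) coherence of a matrix $A$ is $$\mu(A)=\max_{j\ne k}\frac{|\langle A_j,A_k\rangle|}{\|A_j\|_2\|A_k\|_2}.$$
   Formalization: As printed the claim is false; the formal version assumes that every linearization at an iterate has unit-norm columns, assumes the coherence bound also at n=0, and has the error term at index n−1 (linearization at x_{n−1} and e_{n−1}) instead of n. *)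

(* Defs.v *)
From HB Require Import structures.
From mathcomp Require Import all_boot all_order all_algebra.
From mathcomp Require Import all_classical all_reals all_analysis.

Set Implicit Arguments.
Unset Strict Implicit.
Unset Printing Implicit Defensive.

Import Order.TTheory GRing.Theory Num.Theory.
Import numFieldNormedType.Exports.

Local Open Scope ring_scope.

(* Common interface to the real and the complex numbers: conjugation and the
   square root of nonnegative scalars. As usual for numFieldType, norms take
   their values in the field itself. *)
Record scalarField := ScalarField {
  scalar :> numFieldType;
  conjS : {rmorphism scalar -> scalar};
  sqrtS : scalar -> scalar;
  mul_conjS : forall z : scalar, z * conjS z = `|z| ^+ 2;
  sqrtS_ge0 : forall z : scalar, 0 <= z -> 0 <= sqrtS z;
  sqr_sqrtS : forall z : scalar, 0 <= z -> sqrtS z ^+ 2 = z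
}.

Section Instances.

Let real_mul_conj (R : rcfType) (z : R) : z * idfun z = `|z| ^+ 2.
Proof. by rewrite /= -expr2 real_normK ?num_real. Qed.

Definition real_scalars (R : rcfType) : scalarField :=
  @ScalarField R idfun Num.sqrt (@real_mul_conj R)
    (fun z _ => sqrtr_ge0 z) (@sqr_sqrtr R).

Let complex_mul_conj (C : numClosedFieldType) (z : C) :
  z * Num.conj z = `|z| ^+ 2.
Proof. by rewrite normCK. Qed.

Let complex_sqrt_ge0 (C : numClosedFieldType) (z : C) :
  0 <= z -> 0 <= sqrtC z.
Proof. by rewrite sqrtC_ge0. Qed.

Let complex_sqr_sqrt (C : numClosedFieldType) (z : C) :
  0 <= z -> sqrtC z ^+ 2 = z.
Proof. by move=> _; exact: sqrtCK. Qed.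

Definition complex_scalars (C : numClosedFieldType) : scalarField :=
  @ScalarField C Num.conj sqrtC (@complex_mul_conj C)
    (@complex_sqrt_ge0 C) (@complex_sqr_sqrt C).

End Instances.

Section Notions.
Variable K : scalarField.

Definition adjoint (m n : nat) (A : 'M[K]_(m, n)) : 'M[K]_(n, m) :=
  map_mx (conjS K) A^T.

Definition inner (m : nat) (u v : 'cV[K]_m) : K :=
  \sum_(i < m) u i 0 * conjS K (v i 0).

Definition norm1 (n : nat) (v : 'cV[K]_n) : K := \sum_(i < n) `|v i 0|.

Definition norm2 (n : nat) (v : 'cV[K]_n) : K :=
  sqrtS (\sum_(i < n) `|v i 0| ^+ 2).

Definition normInf (n : nat) (v : 'cV[K]_n) : K :=
  \big[Num.max/0]_(i < n) `|v i 0|.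

(* All the quotients are nonnegative, so the default value 0 of the maximum
   only matters when n <= 1, where there is no pair j <> k. *)
Definition coherence (m n : nat) (A : 'M[K]_(m, n)) : K :=
  \big[Num.max/0]_(jk : 'I_n * 'I_n | jk.1 != jk.2)
    (`|inner (col jk.1 A) (col jk.2 A)| /
       (norm2 (col jk.1 A) * norm2 (col jk.2 A))).

Definition unit_columns (m n : nat) (A : 'M[K]_(m, n)) : Prop :=
  forall j, norm2 (col j A) = 1.

Definition sparse (n s : nat) (v : 'cV[K]_n) : Prop :=
  (#|[set i | (v i 0 != 0)%R]| <= s)%N.

(* H keeps s entries of largest absolute value (all entries if s exceeds the
   length) and sets the others to zero; ties are broken arbitrarily. *)
Definition hard_thresholding (n s : nat) (H : 'cV[K]_n -> 'cV[K]_n) : Prop :=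
  forall u : 'cV[K]_n, exists T : {set 'I_n},
    [/\ #|T| = minn s n,
        forall i j, i \in T -> j \notin T -> `|u j 0| <= `|u i 0|
      & H u = \col_i (if i \in T then u i 0 else 0)].

(* A is the Jacobian matrix of Phi at a: Phi is (Frechet) differentiable at a
   with differential v |-> A v. *)
Definition linearization (m n : nat) (Phi : 'cV[K]_n -> 'cV[K]_m)
    (a : 'cV[K]_n) (A : 'M[K]_(m, n)) : Prop :=
  is_diff a Phi (fun v : 'cV[K]_n => A *m v).

End Notions.

(* Main.v *)
(* With A = L (x_n) and u the vector that is thresholded to produce x_(n+1),
   u - x = (I - A^* A)(x_n - x) + A^* e_n. Since A has unit columns, I - A^* A
   vanishes on the diagonal and is bounded by mu0 off it, so every entry of u - x
   is at most c = mu0 * |x_n - x|_1 + |A^* e_n|_oo. Thresholding keeps s entries,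
   each off by at most c; on a discarded entry i of the support of x, |u i| is
   dominated by a kept entry outside the support, hence by c, and |x i| <= 2c.
   This sums to at most 3sc. *)
Require Import Defs.
From mathcomp Require Import all_boot all_order all_algebra.
From mathcomp Require Import all_classical all_reals all_analysis.
Import Order.TTheory GRing.Theory Num.Theory.

Local Open Scope ring_scope.

(* The order of a numFieldType is only partial, so the bigmax lemmas for total
   orders do not apply. *)
Lemma bigmax_nneg_bounds (F : numDomainType) (I : eqType) (r : seq I)
    (P : pred I) (f : I -> F) (f_ge0 : forall i, 0 <= f i) :
  0 <= \big[Num.max/0]_(i <- r | P i) f i /\
  forall i, i \in r -> P i -> f i <= \big[Num.max/0]_(j <- r | P j) f j.
Proof.
elim: r => [|a r [IH0 IH]]; first by rewrite big_nil.
rewrite big_cons; case: ifP => Pa; last first.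
  by split=> // i; rewrite inE => /orP[/eqP-> | /IH //]; rewrite Pa.
(* Nonnegative elements are real, hence comparable; this is why nonnegativity of the running maximum
   is part of the induction. *)
have [le_aM|/ltW le_Ma] := real_leP (ger0_real (f_ge0 a)) (ger0_real IH0).
  split=> // i; rewrite inE => /orP[/eqP-> // | /IH]; exact.
split=> // i; rewrite inE => /orP[/eqP-> // | ri Pi].
exact: le_trans (IH i ri Pi) le_Ma.
Qed.

Section Estimates.
Variable K : scalarField.

Lemma norm1_ge0 (n : nat) (v : 'cV[K]_n) : 0 <= norm1 v.
Proof. exact: sumr_ge0. Qed.

Lemma normInf_ge0 (n : nat) (v : 'cV[K]_n) : 0 <= normInf v.
Proof. by apply: (bigmax_nneg_bounds _ _ _ _ _ _).1. Qed.

Lemma le_normInf (n : nat) (v : 'cV[K]_n) i : `|v i 0| <= normInf v.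
Proof.
by apply: (bigmax_nneg_bounds _ _ _ _ (fun i => `|v i 0|) _).2; rewrite ?mem_index_enum.
Qed.

Lemma norm2_ge0 (n : nat) (v : 'cV[K]_n) : 0 <= norm2 v.
Proof. by apply/sqrtS_ge0/sumr_ge0 => i _; rewrite exprn_ge0. Qed.

Lemma inner_self (n : nat) (v : 'cV[K]_n) : inner v v = norm2 v ^+ 2.
Proof.
rewrite sqr_sqrtS; first by apply: eq_bigr => i _; rewrite mul_conjS.
by apply: sumr_ge0 => i _; rewrite exprn_ge0.
Qed.

(** The indices swap because [inner] conjugates its second argument. *)
Lemma adjoint_mulmx_inner (m n : nat) (A : 'M[K]_(m, n)) i j :
  (adjoint A *m A) i j = inner (col j A) (col i A).
Proof. by rewrite mxE; apply: eq_bigr => k _; rewrite !mxE mulrC. Qed.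

Lemma coherence_ge0 (m n : nat) (A : 'M[K]_(m, n)) : 0 <= coherence A.
Proof.
apply: (bigmax_nneg_bounds _ _ _ _ _ _).1 => jk.
by rewrite divr_ge0 ?mulr_ge0 ?norm2_ge0.
Qed.

Lemma inner_le_coherence (m n : nat) (A : 'M[K]_(m, n)) j k :
  unit_columns A -> j != k -> `|inner (col j A) (col k A)| <= coherence A.
Proof.
move=> unitA neq_jk.
have -> : `|inner (col j A) (col k A)| =
    `|inner (col j A) (col k A)| / (norm2 (col j A) * norm2 (col k A)).
  by rewrite !unitA mulr1 divr1.
apply: ((bigmax_nneg_bounds _ _ _ (fun jk => jk.1 != jk.2)
  (fun jk : 'I_n * 'I_n => `|inner (col jk.1 A) (col jk.2 A)| /
    (norm2 (col jk.1 A) * norm2 (col jk.2 A))) _).2 (j, k)) => //.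
- by move=> jk; rewrite divr_ge0 ?mulr_ge0 ?norm2_ge0.
- by rewrite mem_index_enum.
Qed.

Lemma gram_deviation_le (m n : nat) (A : 'M[K]_(m, n)) (v : 'cV[K]_n) i :
  unit_columns A ->
  `|(v - adjoint A *m (A *m v)) i 0| <= coherence A * norm1 v.
Proof.
move=> unitA.
(* The diagonal Gram entry is the squared norm of a unit column, so [v i 0] cancels. *)
have -> : (v - adjoint A *m (A *m v)) i 0 =
    - \sum_(j | j != i) (adjoint A *m A) i j * v j 0.
  rewrite mulmxA !mxE (bigD1 i) //= adjoint_mulmx_inner inner_self unitA.
  by rewrite expr1n mul1r opprD addrA subrr add0r.
rewrite normrN (le_trans (ler_norm_sum _ _ _)) // /norm1 mulr_sumr.
(* The full [norm1 v] also contains the nonnegative term at [i], which is dropped. *)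
rewrite [leRHS](bigD1 i) //= ler_wpDl ?mulr_ge0 ?coherence_ge0 //.
apply: ler_sum => j neq_ji.
by rewrite normrM ler_wpM2r // adjoint_mulmx_inner inner_le_coherence.
Qed.

Lemma hard_thresholding_error (n s : nat) (H : 'cV[K]_n -> 'cV[K]_n)
    (u x : 'cV[K]_n) (c : K) :
  hard_thresholding s H -> sparse s x -> 0 <= c ->
  (forall i, `|(u - x) i 0| <= c) -> norm1 (H u - x) <= (3 * s)%:R * c.
Proof.
move=> hH sx c_ge0 le_c; have [T [cardT maxT ->]] := hH u.
set S := [set i | (x i 0 != 0)%R] in sx.
have le_ST : (#|S| <= #|T|)%N.
  by rewrite cardT leq_min sx -[leqRHS]card_ord max_card.
have missed i : i \in S :\: T -> `|x i 0| <= c *+ 2.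
  (* Removing the common part from [S] and [T] preserves [le_ST], so a support index lost by [T]
     forces [T] to keep an index outside [S]. *)
  move=> STi; have : (0 < #|T :\: S|)%N.
    have : (0 < #|S :\: T|)%N by apply/card_gt0P; exists i.
    by rewrite !cardsD (finset.setIC T) !subn_gt0 => /leq_trans; apply.
  case/card_gt0P=> j; rewrite !inE negbK => /andP[/eqP xj0 Tj].
  move: STi; rewrite inE => /andP[nTi _].
  have le_u : `|u i 0| <= c.
    apply: le_trans (maxT _ _ Tj nTi) _.
    by have := le_c j; rewrite !mxE xj0 subr0.
  have -> : x i 0 = u i 0 - (u - x) i 0 by rewrite !mxE subKr.
  by rewrite mulr2n (le_trans (ler_normB _ _)) // lerD.
(* Booleans act as multiplicities: the error is at most [c] on [T], twice [c] on the missed support,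
   and zero elsewhere, so summation reduces to cardinalities. *)
have bound i : `|(\col_i (if i \in T then u i 0 else 0) - x) i 0| <=
    c *+ (i \in T) + c *+ 2 *+ (i \in S :\: T).
  have := le_c i; rewrite !mxE; case: ifP => Ti le_ci.
    by rewrite inE Ti mulr0n addr0.
  rewrite sub0r normrN add0r; case: (boolP (i \in S :\: T)) => [/missed // | ].
  by rewrite !inE Ti /= negbK => /eqP->; rewrite normr0.
apply: le_trans (ler_sum _ (fun i _ => bound i)) _.
have card_sum (A : {set 'I_n}) : (\sum_i (i \in A) = #|A|)%N.
  by rewrite -sum1_card [RHS]big_mkcond; apply: eq_bigr => i _; case: (i \in A).
rewrite big_split /= !sumrMnr !card_sum -mulrnA -mulrnDr -[leLHS]mulr_natl.
rewrite ler_wpM2r // ler_nat (mulSn 2 s) leq_add //; first by rewrite cardT geq_minl.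
by rewrite leq_mul2l (leq_trans _ sx) // subset_leq_card // subsetDl.
Qed.

End Estimates.

(** The error term has index [n.-1] because the matrix producing [x_ n] is the linearization at
    [x_ n.-1]; the first step therefore uses the one at [x_ 0]. *)
Theorem theorem2p1 (K : scalarField) (m N s : nat)
    (Phi : 'cV[K]_N -> 'cV[K]_m)
    (L : 'cV[K]_N -> 'M[K]_(m, N))
    (H : 'cV[K]_N -> 'cV[K]_N)
    (x : 'cV[K]_N) (eps y : 'cV[K]_m)
    (x_ : nat -> 'cV[K]_N) (mu0 : K)
    (hy : y = Phi x + eps)
    (hL : forall n : nat, linearization Phi (x_ n) (L (x_ n)))
    (hunit : forall n : nat, unit_columns (L (x_ n)))
    (hH : hard_thresholding s H)
    (hiter : forall n : nat,
      x_ n.+1 = H (x_ n + adjoint (L (x_ n)) *m (y - L (x_ n) *m x_ n)))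
    (hcoh : forall n : nat, coherence (L (x_ n)) <= mu0)
    (hx : sparse s x)
    (hmu0 : mu0 < 1 / (3 * s + 1)%:R) :
  let e := fun n : nat => Phi x - L (x_ n) *m x + eps in
  let rho := mu0 * (3 * s + 1)%:R in
  forall n : nat, (1 <= n)%N ->
    norm1 (x_ n - x) <=
      rho * norm1 (x_ n.-1 - x)
      + (3 * s + 1)%:R * normInf (adjoint (L (x_ n.-1)) *m e n.-1).
Proof.
move=> e rho [//|n] _ /=.
set A := L (x_ n); set d := x_ n - x; set w := adjoint A *m e n.
pose c := mu0 * norm1 d + normInf w.
have mu0_ge0 : 0 <= mu0 by apply: le_trans (hcoh 0%N); apply: coherence_ge0.
have c_ge0 : 0 <= c by rewrite addr_ge0 ?normInf_ge0 ?mulr_ge0 ?norm1_ge0.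
have -> : rho * norm1 d + (3 * s + 1)%:R * normInf w = (3 * s + 1)%:R * c.
  by rewrite mulrDr mulrA [rho]mulrC.
(* Thresholding yields the sharper factor [3 * s], which is relaxed to [3 * s + 1]. *)
apply: (@le_trans _ _ ((3 * s)%:R * c)); last first.
  by rewrite ler_wpM2r // ler_nat leq_addr.
rewrite hiter; apply: hard_thresholding_error => // i.
have -> : x_ n + adjoint A *m (y - A *m x_ n) - x =
    (d - adjoint A *m (A *m d)) + w.
  (* Adding and subtracting [A *m x] splits the residual into model error and the image of [d]. *)
  have -> : y - A *m x_ n = e n - A *m d.
    by rewrite hy /e mulmxBr -/A opprB addrA; congr (_ - _); rewrite addrAC subrK.
  by rewrite mulmxBr -/w addrAC -/d addrCA addrC.
rewrite mxE (le_trans (ler_normD _ _)) // lerD ?le_normInf //.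
apply: le_trans (gram_deviation_le _ _ _ _ _ _ (hunit n)) _.
by rewrite ler_wpM2r ?norm1_ge0 ?hcoh.
Qed.
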